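(* Let $n\ge 2$ be an integer. For $1\le j\le n-1$ and $0\le k\le n-1$ put $S_j(k):=\sin\!\big(\tfrac{2\pi kj}{n}+\tfrac{\pi}{4}\big)$, let \[ c_n:=\max_{1\le j\le n-1}\ \max_{0\le k,l\le n-1} S_j(k)\,S_j(l), \] and let \[ \Delta_n:=\min_{m,t\in\mathbb Z}\left|\frac{2\pi m}{n}-\frac{(2t+1)\pi}{4}\right|. \] Then \[ c_n=\cos^2\Delta_n\qquad\text{and}\qquad \Delta_n=\frac{\pi}{4n}\,\rho(n), \] where \[ \rho(n)= \begin{cases} 0,& n\equiv 0\pmod 8,\\ 1,& n\equiv 1,3,5,7\pmod 8,\\ 2,& n\equiv 2,6\pmod 8,\\ 4,& n\equiv 4\pmod 8. \end{cases} \] Moreover, the maximum defining $c_n$ is attained at some triple $(j,k,l)$ with $k=l$.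
   Context: All objects are defined in the claim. *)

(* Defs.v *)
From mathcomp Require Import all_boot all_order all_algebra.
From mathcomp Require Import all_classical all_reals all_analysis.

Import Order.TTheory GRing.Theory Num.Theory.

Local Open Scope classical_set_scope.
Local Open Scope ring_scope.

Definition is_maximum {R : realType} (A : set R) (x : R) : Prop :=
  A x /\ ubound A x.

Definition is_minimum {R : realType} (A : set R) (x : R) : Prop :=
  A x /\ lbound A x.

Definition sinS (R : realType) (n j k : nat) : R :=
  sin (2 * pi * k%:R * j%:R / n%:R + pi / 4).

Definition products (R : realType) (n : nat) : set R :=
  [set x | exists j k l : nat,
     [/\ (1 <= j <= n - 1)%N, (k <= n - 1)%N, (l <= n - 1)%N
       & x = sinS R n j k * sinS R n j l]].

(* The maximum is written as a [sup]; that it is attained is a separate claim,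
   expressed by [is_maximum (products R n) (cmax R n)]. *)
Definition cmax (R : realType) (n : nat) : R := sup (products R n).

Definition distances (R : realType) (n : nat) : set R :=
  [set x | exists m t : int,
     x = `|2 * pi * m%:~R / n%:R - (2 * t + 1)%:~R * pi / 4|].

(* As for [cmax], attainment is expressed by
   [is_minimum (distances R n) (Delta R n)]. *)
Definition Delta (R : realType) (n : nat) : R := inf (distances R n).

Definition rho (n : nat) : nat :=
  match (n %% 8)%N with
  | 0 => 0
  | 1 | 3 | 5 | 7 => 1
  | 2 | 6 => 2
  | _ => 4 (* n %% 8 = 4 *)
  end%N.

(* Main.v *)
Require Import Defs.
From mathcomp Require Import all_boot all_order all_algebra.
From mathcomp Require Import all_classical all_reals all_analysis.
From mathcomp Require Import zify ring lra.

Import Order.TTheory GRing.Theory Num.Theory.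

Local Open Scope classical_set_scope.
Local Open Scope ring_scope.

(** Everything reduces to one integer problem.  Multiplying by [4 * n / pi], the
    distance from [2 pi m / n] to [(2 t + 1) pi / 4] becomes the integer
    [`|8 * m - (2 * t + 1) * n|].  Its residue modulo 1, 2, 4 or 8, according to
    [n %% 8], bounds it below by [rho n] ([rho_le]), and explicit [m], [t] reach
    that bound ([rho_attained]); this evaluates [Delta].

    For the sines, [S_j(k) S_j(l) <= (S_j(k)^2 + S_j(l)^2) / 2], so only squares
    matter.  The square of [sin x] is the square of the cosine of the distance
    from [x] to the nearest point of [pi / 2 + pi Z] ([sqr_sin_le_cos]).  For
    [x = 2 pi k j / n + pi / 4] these distances are those from [2 pi k j / n] to
    [(4 s + 1) pi / 4] ([sinS_angle]), hence at least [Delta], which gives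
    [c_n <= cos^2 Delta].

    Equality needs a minimising pair whose odd multiple of [pi / 4] is congruent
    to 1 modulo 4: the odd multiples congruent to 3 are zeros, not extrema, of
    [sin (theta + pi / 4)].  The symmetry [theta -> - theta] exchanges the two
    classes and [theta] only matters modulo [2 pi], so such a pair exists with
    [0 <= m < n], and the triple [(1, m, m)] attains the maximum. *)

Lemma is_maximum_sup (R : realType) (A : set R) (x : R) :
  is_maximum A x -> sup A = x.
Proof.
move=> [Ax ubx]; apply/eqP; rewrite eq_le; apply/andP; split.
  by apply: ge_sup => //; exists x.
by apply: ub_le_sup Ax; exists x.
Qed.

Lemma is_minimum_inf (R : realType) (A : set R) (x : R) :
  is_minimum A x -> inf A = x.
Proof.
move=> [Ax lbx]; apply/eqP; rewrite eq_le; apply/andP; split.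
  by apply: ge_inf Ax; exists x.
by apply: lb_le_inf => //; exists x.
Qed.

Lemma sqr_sinD_intpi (R : realType) (x : R) (s : int) :
  sin (x + s%:~R * pi) ^+ 2 = sin x ^+ 2.
Proof.
have natcase (k : nat) (y : R) : sin (y + k%:R * pi) ^+ 2 = sin y ^+ 2.
  elim: k => [|k IH]; first by rewrite mul0r addr0.
  by rewrite -natr1 mulrDl mul1r addrA sinDpi sqrrN IH.
case: s => k; first exact: natcase.
by rewrite -[LHS](natcase k.+1) NegzE mulrNz mulNr subrK.
Qed.

(** Reducing [x] modulo [pi] to [u] in [[0, pi]], the sine of [u] is the cosine of
    [`|u - pi / 2|], which lies in [[0, pi / 2]] where the cosine decreases. *)
Lemma sqr_sin_le_cos (R : realType) (x d : R) :
    0 <= d -> (forall s : int, d <= `|x - pi / 2 - s%:~R * pi|) ->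
  sin x ^+ 2 <= cos d ^+ 2.
Proof.
move=> d0 dist; have pi0 := pi_gt0 R.
set s := Num.floor (x / pi); pose u := x - s%:~R * pi.
have /andP[sx xs] := floor_itv (x / pi).
have u0 : 0 <= u by rewrite subr_ge0 -ler_pdivlMr.
have upi : u <= pi.
  move: xs; rewrite ltr_pdivrMr// rmorphD /= -/s /u; lra.
have du : d <= `|u - pi / 2| by rewrite addrAC; exact: dist.
have u2 : `|u - pi / 2| <= pi / 2 by rewrite ler_norml; lra.
have -> : x = u + s%:~R * pi by rewrite subrK.
rewrite sqr_sinD_intpi -cosBpihalf -cos_norm.
have c0 : 0 <= cos `|u - pi / 2|.
  by apply: cos_ge0_pihalf; rewrite u2 andbT (le_trans _ (normr_ge0 _))//; lra.
rewrite lerXn2r ?nnegrE//.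
  by apply: cos_ge0_pihalf; lra.
by rewrite leNgt ltr_cos ?in_itv/= -?leNgt//; lra.
Qed.

(** A congruence: for [n] odd the integer inside is odd; for [n = 2 mod 4] it is
    2 modulo 4; for [n = 4 mod 8] it is 4 modulo 8. *)
Lemma rho_le (n : nat) (m t : int) :
  (rho n)%:Z <= `|8 * m - (2 * t + 1) * n%:Z|.
Proof.
rewrite /rho; move: (ltn_pmod n (erefl : 0 < 8)%N) (divn_eq n 8).
move: (n %% 8)%N (n %/ 8)%N => r q.
by do 8! [case: r => [|r] /=; first by move=> _ ->; lia].
Qed.

(** The odd factor is restricted to the form [4 * s + 1] and [k] to a full period
    [0 <= k < n], so that the same witness serves for the minimal distance and
    for the maximal sine.  With [n = 8 q + r], the factor 1 works unless [r] is 3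
    or 5; there [5 * n] is 7 resp. 1 modulo 8, and the factor 5 works. *)
Lemma rho_attained (n : nat) : (2 <= n)%N ->
  exists (k : nat) (s : int), (k <= n - 1)%N /\
    `|8 * k%:Z - (4 * s + 1) * n%:Z| = (rho n)%:Z.
Proof.
rewrite /rho; move: (ltn_pmod n (erefl : 0 < 8)%N) (divn_eq n 8).
move: (n %% 8)%N (n %/ 8)%N => r q.
case: r => [|r]; first by move=> _ -> h; exists q, 0; lia.
case: r => [|r]; first by move=> _ -> h; exists q, 0; lia.
case: r => [|r]; first by move=> _ -> h; exists q, 0; lia.
case: r => [|r]; first by move=> _ -> h; exists (5 * q + 2)%N, 1; lia.
case: r => [|r]; first by move=> _ -> h; exists q, 0; lia.
case: r => [|r]; first by move=> _ -> h; exists (5 * q + 3)%N, 1; lia.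
case: r => [|r]; first by move=> _ -> h; exists q.+1, 0; lia.
case: r => [|r]; first by move=> _ -> h; exists q.+1, 0; lia.
by [].
Qed.

Lemma distanceE (R : realType) (n : nat) (m t : int) : (0 < n)%N ->
  2 * pi * m%:~R / n%:R - (2 * t + 1)%:~R * pi / 4 =
  pi / (4 * n%:R) * (8 * m - (2 * t + 1) * n%:Z)%:~R :> R.
Proof.
move=> n0; have n0' : n%:R != 0 :> R by rewrite pnatr_eq0 -lt0n.
rewrite !(rmorphB, rmorphD, rmorphM) /= -pmulrn.
by field.
Qed.

Lemma norm_distance (R : realType) (n : nat) (m t : int) : (0 < n)%N ->
  `|2 * pi * m%:~R / n%:R - (2 * t + 1)%:~R * pi / 4| =
  pi / (4 * n%:R) * (`|8 * m - (2 * t + 1) * n%:Z|)%:~R :> R.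
Proof.
move=> n0; rewrite distanceE// normrM intr_norm ger0_norm//.
by rewrite divr_ge0 ?pi_ge0.
Qed.

(** The shift by [pi / 4] in [sinS] turns the extrema [pi / 2 + s pi] of the sine
    into the odd multiples [(2 (2 s) + 1) pi / 4] occurring in [distances]. *)
Lemma sinS_angle (R : realType) (n j k : nat) (s : int) : (0 < n)%N ->
  2 * pi * k%:R * j%:R / n%:R + pi / 4 - pi / 2 - s%:~R * pi =
  2 * pi * (k * j)%:Z%:~R / n%:R - (2 * (2 * s) + 1)%:~R * pi / 4 :> R.
Proof.
move=> n0; have n0' : n%:R != 0 :> R by rewrite pnatr_eq0 -lt0n.
rewrite -(pmulrn 1 (k * j)) natrM !(rmorphD, rmorphM) /=.
by field.
Qed.

Theorem lemma2 (R : realType) (n : nat) (hn : (2 <= n)%N) :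
  [/\ is_maximum (products R n) (cmax R n),
      is_minimum (distances R n) (Delta R n),
      cmax R n = cos (Delta R n) ^+ 2,
      Delta R n = pi / (4 * n%:R) * (rho n)%:R
    & exists j k l : nat,
        [/\ (1 <= j <= n - 1)%N, (k <= n - 1)%N, (l <= n - 1)%N,
            k = l & sinS R n j k * sinS R n j l = cmax R n]].
Proof.
have n0 : (0 < n)%N by lia.
have [k [s [kn ks]]] := rho_attained n hn.
have ks' : `|8 * k%:Z - (2 * (2 * s) + 1) * n%:Z| = (rho n)%:Z.
  by rewrite -ks mulrA.
set d : R := pi / (4 * n%:R) * (rho n)%:R.
have d0 : 0 <= d by rewrite mulr_ge0// divr_ge0 ?pi_ge0.
have le_d m t : d <= `|2 * pi * m%:~R / n%:R - (2 * t + 1)%:~R * pi / 4|.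
  rewrite norm_distance// ler_wpM2l ?divr_ge0 ?pi_ge0// pmulrn ler_int.
  exact: rho_le.
have d_att : `|2 * pi * k%:Z%:~R / n%:R - (2 * (2 * s) + 1)%:~R * pi / 4| = d.
  by rewrite norm_distance// ks'.
have min_d : is_minimum (distances R n) d.
  by split=> [|_ [m [t ->]]]; [exists k, (2 * s)|exact: le_d].
have Dd : Delta R n = d by exact: is_minimum_inf.
have sin_le j l : sinS R n j l ^+ 2 <= cos d ^+ 2.
  by apply: sqr_sin_le_cos => // t; rewrite sinS_angle.
have sin_att : sinS R n 1 k * sinS R n 1 k = cos d ^+ 2.
  rewrite -expr2 /sinS -(sqr_sinD_intpi R _ (- s)) -cosBpihalf -cos_norm.
  by rewrite -d_att -[in RHS](muln1 k) -sinS_angle// rmorphN mulNr addrAC.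
have max_c : is_maximum (products R n) (cos d ^+ 2).
  split; first by exists 1%N, k, k; split=> //; lia.
  move=> _ [j [a [b [_ _ _ ->]]]].
  have := sin_le j a; have := sin_le j b.
  have := sqr_ge0 (sinS R n j a - sinS R n j b).
  nra.
have Cc : cmax R n = cos d ^+ 2 by exact: is_maximum_sup.
rewrite Cc Dd; split=> //.
by exists 1%N, k, k; split=> //; lia.
Qed.
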